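(* For all integers $k,N\ge 0$ and all $x\in\mathbb{R}$, \[ p_{k+N}(x)=\sum_{i=0}^{\left[\frac{N+1}{2}\right]}\sum_{l=0}^{k}\binom{k}{l}(N-2i)_{l}\,2^{l}\,a_{i}(N)\,\langle x\rangle_{N-i}\,p_{k-l}(x+N-i), \] where $a_{0}(N)=1$ for all $N\ge0$; $a_{\frac{N+1}{2}}(N)=0$ whenever $N$ is an odd positive integer; and for $1\le i\le\left[\frac{N}{2}\right]$, \[ a_{i}(N)=2^{i}\sum_{k_{i}=1}^{N-2i+1}\sum_{k_{i-1}=1}^{k_{i}+1}\cdots\sum_{k_{1}=1}^{k_{2}+1}\left(\prod_{l=1}^{i}k_{l}\right). \]
   Context: For $x\in\mathbb{R}$, the convolved Fibonacci numbers $p_n(x)$, $n\ge 0$, are defined by \[ \left(\frac{1}{1-t-t^{2}}\right)^{x}=\sum_{n=0}^{\infty}p_{n}(x)\frac{t^{n}}{n!}. \] $[y]$ denotes the greatest integer not exceeding $y$. The falling factorial is $(y)_n=y(y-1)\cdots(y-n+1)$ for $n\ge1$, $(y)_0=1$; the rising factorial is $\langle x\rangle_n=x(x+1)\cdots(x+n-1)$ for $n\ge1$, $\langle x\rangle_0=1$. In the nested sum defining $a_i(N)$, the outermost index $k_i$ runs from $1$ to $N-2i+1$ and each inner index $k_{j-1}$ runs from $1$ to $k_j+1$. *)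

(* Defs.v *)
From Stdlib Require Import Reals List Arith.
From Coquelicot Require Import Coquelicot.
Import ListNotations.
Open Scope R_scope.

(* Near t = 0 one has 1 - t - t^2 > 0, so Rpower is the genuine real power. *)
Definition convolved_fibonacci (p : nat -> R -> R) : Prop :=
  forall x : R,
    locally (0 : R) (fun t : R =>
      is_series (fun n : nat => p n x * (t ^ n / INR (fact n)))
                (Rpower (1 / (1 - t - t ^ 2)) x)).

Fixpoint falling (y : R) (n : nat) : R :=
  match n with
  | O => 1
  | S m => falling y m * (y - INR m)
  end.

Fixpoint rising (x : R) (n : nat) : R :=
  match n with
  | O => 1
  | S m => rising x m * (x + INR m)
  end.

(* nested_sum i m f is the sum of f [k_i; ...; k_1] over 1 <= k_i <= m and
   1 <= k_(j-1) <= k_j + 1 for 2 <= j <= i. *)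
Fixpoint nested_sum (i m : nat) (f : list nat -> R) : R :=
  match i with
  | O => f []
  | S j => sum_n_m (fun k => nested_sum j (k + 1) (fun ks => f (k :: ks))) 1 m
  end.

Definition prod_of_list (ks : list nat) : R :=
  fold_right (fun k acc => INR k * acc) 1 ks.

(* For i <= (N + 1) / 2 the last branch is reached only when N is odd and
   i = (N + 1) / 2. In the middle branch 2 * i <= N, so N - 2 * i is exact. *)
Definition coef_a (i N : nat) : R :=
  if (i =? 0)%nat then 1
  else if (i <=? N / 2)%nat
       then 2 ^ i * nested_sum i (N - 2 * i + 1) prod_of_list
       else 0.

(* Main.v *)
(* Near t = 0 the powers f_x = (1 - t - t^2)^(-x) satisfy
   f_x' = x (1 + 2 t) f_(x+1), hence by induction on N
     f_x^(N) = sum_i a_i(N) <x>_(N-i) (1 + 2 t)^(N-2i) f_(x+N-i),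
   the induction step being the recurrence
   a_(i+1)(N+1) = a_(i+1)(N) + 2 (N - 2i) a_i(N), which peels off the last term
   of the outermost sum of a_(i+1)(N+1). On exponential generating functions the
   N-th derivative is a shift by N and a product is a binomial convolution, so
   the theorem is this formula read on the coefficients of t^k / k!. *)

Require Import Defs.
From Stdlib Require Import Reals Arith Lia Lra.
From Coquelicot Require Import Coquelicot.
Open Scope R_scope.

(** * Sums, falling factorials and nested sums *)

Lemma sum_f_R0_extend (f : nat -> R) (m n : nat) :
  (m <= n)%nat -> (forall i, (m < i <= n)%nat -> f i = 0) ->
  sum_f_R0 f n = sum_f_R0 f m.
Proof.
  induction 1 as [|n H IH]; intros Hf; [reflexivity|].
  rewrite tech5, IH, Hf by (intros; try apply Hf; lia); ring.
Qed.

Lemma is_derive_sum_f_R0 (f : nat -> R -> R) (d : nat -> R) (n : nat) (t : R) :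
  (forall i, (i <= n)%nat -> is_derive (f i) t (d i)) ->
  is_derive (fun u => sum_f_R0 (fun i => f i u) n) t (sum_f_R0 d n).
Proof.
  intros Hf; rewrite <- sum_n_Reals.
  apply (is_derive_ext (fun u => sum_n (fun i => f i u) n)).
  - intros u; apply sum_n_Reals.
  - apply (is_derive_sum_n (K := R_AbsRing) (V := R_NormedModule)), Hf.
Qed.

Lemma falling_succ_l (y : R) (n : nat) :
  falling y (S n) = y * falling (y - 1) n.
Proof.
  induction n as [|n IH]; [simpl; ring|].
  change (falling y (S n) * (y - INR (S n))
          = y * (falling (y - 1) n * (y - 1 - INR n))).
  rewrite IH, S_INR; ring.
Qed.

Lemma falling_add_1 (y : R) (n : nat) :
  falling (y + 1) n = falling y n + INR n * falling y (pred n).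
Proof.
  destruct n as [|n]; [simpl; ring|].
  rewrite falling_succ_l; replace (y + 1 - 1) with y by ring.
  rewrite S_INR; simpl; ring.
Qed.

Lemma nested_sum_scal (i : nat) (c : R) : forall (m : nat) (f : list nat -> R),
  nested_sum i m (fun ks => c * f ks) = c * nested_sum i m f.
Proof.
  induction i as [|i IH]; intros m f; simpl; [reflexivity|].
  rewrite <- (sum_n_m_mult_l (K := R_Ring) c).
  apply sum_n_m_ext; intros j.
  exact (IH (j + 1)%nat (fun ks => f (cons j ks))).
Qed.

Lemma nested_sum_prod_of_list_succ (i m : nat) :
  nested_sum (S i) (S m) prod_of_list =
  nested_sum (S i) m prod_of_list
    + INR (S m) * nested_sum i (S m + 1) prod_of_list.
Proof.
  rewrite <- nested_sum_scal.
  apply (sum_n_Sm (G := R_AbelianMonoid)); lia.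
Qed.

(** * The coefficients a_i(N) *)

Lemma coef_a_eq_0 (i N : nat) :
  (0 < i)%nat -> (N < 2 * i)%nat -> coef_a i N = 0.
Proof.
  intros Hi HN; unfold coef_a.
  pose proof (Nat.div_mod_eq N 2).
  destruct (Nat.eqb_spec i 0); [lia|].
  destruct (Nat.leb_spec i (N / 2)); [lia | reflexivity].
Qed.

(* For 2 i = N + 1 the nested sum is empty, in agreement with the convention
   a_((N+1)/2)(N) = 0. *)
Lemma coef_a_nested_sum (i N : nat) : (2 * i <= N + 1)%nat ->
  coef_a i N = 2 ^ i * nested_sum i (N + 1 - 2 * i) prod_of_list.
Proof.
  intros HN; unfold coef_a.
  pose proof (Nat.div_mod_eq N 2); pose proof (Nat.mod_upper_bound N 2).
  destruct (Nat.eqb_spec i 0) as [-> | Hi]; [simpl; ring|].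
  destruct (Nat.leb_spec i (N / 2)).
  - do 2 f_equal; lia.
  - replace (N + 1 - 2 * i)%nat with 0%nat by lia.
    destruct i as [|i]; [lia|]; simpl nested_sum.
    rewrite sum_n_m_zero by lia; symmetry; apply Rmult_0_r.
Qed.

Lemma coef_a_succ (i N : nat) :
  coef_a (S i) (S N) = coef_a (S i) N + 2 * INR (N - 2 * i) * coef_a i N.
Proof.
  destruct (Nat.le_gt_cases N (2 * i)) as [HN | HN].
  - rewrite !(coef_a_eq_0 (S i)) by lia.
    replace (N - 2 * i)%nat with 0%nat by lia; simpl; ring.
  - rewrite !coef_a_nested_sum by lia.
    replace (S N + 1 - 2 * S i)%nat with (S (N + 1 - 2 * S i)) by lia.
    rewrite nested_sum_prod_of_list_succ.
    replace (S (N + 1 - 2 * S i)) with (N - 2 * i)%nat by lia.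
    replace (N - 2 * i + 1)%nat with (N + 1 - 2 * i)%nat by lia.
    simpl pow; ring.
Qed.

Lemma sum_coef_a_succ (T : nat -> R) (N : nat) :
  sum_f_R0 (fun i => coef_a i (S N) * T i) (S N) =
  sum_f_R0 (fun i => coef_a i N * (T i + 2 * INR (N - 2 * i) * T (S i))) N.
Proof.
  assert (Hlast : sum_f_R0 (fun i => coef_a i N * T i) N =
                  sum_f_R0 (fun i => coef_a i N * T i) (S N)).
  { rewrite tech5, (coef_a_eq_0 (S N)) by lia; ring. }
  rewrite (sum_eq _ (fun i => coef_a i N * T i
    + 2 * INR (N - 2 * i) * coef_a i N * T (S i)) N) by (intros; ring).
  rewrite plus_sum, Hlast, (decomp_sum (fun i => coef_a i N * T i)) by lia.
  rewrite (decomp_sum (fun i => coef_a i (S N) * T i)) by lia; simpl pred.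
  change (coef_a 0 (S N)) with (coef_a 0 N).
  rewrite Rplus_assoc, <- plus_sum; f_equal.
  apply sum_eq; intros i _; rewrite coef_a_succ; ring.
Qed.

Lemma sum_coef_a_truncate (T : nat -> R) (N : nat) :
  sum_f_R0 (fun i => coef_a i N * T i) N =
  sum_f_R0 (fun i => coef_a i N * T i) ((N + 1) / 2).
Proof.
  pose proof (Nat.div_mod_eq (N + 1) 2).
  pose proof (Nat.mod_upper_bound (N + 1) 2).
  apply sum_f_R0_extend; [lia|].
  intros i Hi; rewrite coef_a_eq_0 by lia; ring.
Qed.

(** * Exponential generating functions *)

Definition is_egf (u : nat -> R) (f : R -> R) : Prop :=
  locally (0 : R) (fun t : R => is_pseries (fun n => u n / INR (fact n)) t (f t)).

Definition binomial_convolution (u v : nat -> R) (n : nat) : R :=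
  sum_f_R0 (fun l => Binomial.C n l * u l * v (n - l)%nat) n.

Lemma locally_is_pseries_CV_radius (a : nat -> R) (f : R -> R) :
  locally (0 : R) (fun t : R => is_pseries a t (f t)) ->
  locally (0 : R) (fun t : R => Rbar_lt (Rabs t) (CV_radius a)).
Proof.
  intros [e He].
  assert (He2 : 0 < e / 2) by (pose proof (cond_pos e); lra).
  exists (mkposreal (e / 2) He2); intros t Ht.
  apply Rbar_lt_le_trans with (Finite (Rabs (e / 2))).
  - change (Rabs (t - 0) < e / 2) in Ht; rewrite Rminus_0_r in Ht.
    simpl; rewrite (Rabs_pos_eq (e / 2)); lra.
  - apply Rbar_not_lt_le; intros Hlt.
    apply (CV_disk_outside _ _ Hlt), ex_series_lim_0.
    exists (f (e / 2)); apply is_pseries_R, He.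
    change (Rabs (e / 2 - 0) < e); rewrite Rabs_pos_eq; lra.
Qed.

Lemma locally_is_pseries_CV_radius_pos (a : nat -> R) (f : R -> R) :
  locally (0 : R) (fun t : R => is_pseries a t (f t)) ->
  Rbar_lt 0 (CV_radius a).
Proof.
  intros Ha; rewrite <- Rabs_R0.
  exact (locally_singleton _ _ (locally_is_pseries_CV_radius _ _ Ha)).
Qed.

Lemma is_egf_unique (u v : nat -> R) (f : R -> R) (n : nat) :
  is_egf u f -> is_egf v f -> u n = v n.
Proof.
  intros Hu Hv.
  assert (Hcoef : u n / INR (fact n) = v n / INR (fact n)).
  { apply (PSeries_ext_recip (fun n => u n / INR (fact n))
      (fun n => v n / INR (fact n))).
    - exact (locally_is_pseries_CV_radius_pos _ _ Hu).
    - exact (locally_is_pseries_CV_radius_pos _ _ Hv).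
    - generalize (filter_and _ _ Hu Hv); apply filter_imp; intros t [Hut Hvt].
      now rewrite (is_pseries_unique _ _ _ Hut), (is_pseries_unique _ _ _ Hvt). }
  apply Rmult_eq_reg_r in Hcoef; [exact Hcoef|].
  apply Rinv_neq_0_compat, INR_fact_neq_0.
Qed.

Lemma is_egf_ext (u v : nat -> R) (f : R -> R) :
  (forall n, u n = v n) -> is_egf u f -> is_egf v f.
Proof.
  intros Huv; unfold is_egf; apply filter_imp; intros t.
  apply is_pseries_ext; intros n; now rewrite Huv.
Qed.

Lemma is_egf_ext_loc (u : nat -> R) (f g : R -> R) :
  locally (0 : R) (fun t : R => f t = g t) -> is_egf u f -> is_egf u g.
Proof.
  unfold is_egf; intros Hfg Hu; generalize (filter_and _ _ Hfg Hu).
  now apply filter_imp; intros t [<- Ht].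
Qed.

Lemma is_egf_plus (u v : nat -> R) (f g : R -> R) :
  is_egf u f -> is_egf v g ->
  is_egf (fun n => u n + v n) (fun t => f t + g t).
Proof.
  unfold is_egf; intros Hu Hv; generalize (filter_and _ _ Hu Hv).
  apply filter_imp; intros t [Hut Hvt].
  generalize (is_pseries_plus (K := R_AbsRing) (V := R_NormedModule)
    _ _ _ _ _ Hut Hvt).
  apply is_pseries_ext; intros n.
  unfold PS_plus; simpl; unfold plus; simpl; field; apply INR_fact_neq_0.
Qed.

Lemma is_egf_scal (c : R) (u : nat -> R) (f : R -> R) :
  is_egf u f -> is_egf (fun n => c * u n) (fun t => c * f t).
Proof.
  unfold is_egf; apply filter_imp; intros t Ht.
  generalize (is_pseries_scal (K := R_AbsRing) (V := R_NormedModule)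
    c _ _ _ (Rmult_comm t c) Ht).
  apply is_pseries_ext; intros n; symmetry; apply Rmult_assoc.
Qed.

Lemma is_egf_sum (u : nat -> nat -> R) (f : nat -> R -> R) (m : nat) :
  (forall i, is_egf (u i) (f i)) ->
  is_egf (fun n => sum_f_R0 (fun i => u i n) m)
    (fun t => sum_f_R0 (fun i => f i t) m).
Proof.
  intros Hu; induction m as [|m IH]; simpl; [exact (Hu 0%nat)|].
  exact (is_egf_plus _ _ _ _ IH (Hu (S m))).
Qed.

Lemma is_egf_mult (u v : nat -> R) (f g : R -> R) :
  is_egf u f -> is_egf v g ->
  is_egf (binomial_convolution u v) (fun t => f t * g t).
Proof.
  unfold is_egf; intros Hu Hv.
  generalize (filter_and _ _ (filter_and _ _ Hu Hv)
    (filter_and _ _ (locally_is_pseries_CV_radius _ _ Hu)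
      (locally_is_pseries_CV_radius _ _ Hv))).
  apply filter_imp; intros t [[Hut Hvt] [Rut Rvt]].
  generalize (is_pseries_mult _ _ _ _ _ Hut Hvt Rut Rvt).
  apply is_pseries_ext; intros n.
  unfold PS_mult, binomial_convolution, Rdiv.
  rewrite Rmult_comm, scal_sum; apply sum_eq; intros l _.
  unfold Binomial.C; field; repeat split; apply INR_fact_neq_0.
Qed.

Lemma is_egf_mult_id (u : nat -> R) (f : R -> R) :
  is_egf u f -> is_egf (fun n => INR n * u (pred n)) (fun t => t * f t).
Proof.
  unfold is_egf; apply filter_imp; intros t Ht.
  generalize (is_pseries_incr_1 (K := R_AbsRing) (V := R_NormedModule) _ _ _ Ht).
  apply is_pseries_ext; intros [|n].
  - simpl; unfold zero; simpl; field.
  - change (u n / INR (fact n) = INR (S n) * u n / INR (fact (S n))).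
    rewrite fact_simpl, mult_INR; field.
    split; [apply INR_fact_neq_0 | apply not_0_INR; lia].
Qed.

Lemma is_egf_Derive (u : nat -> R) (f : R -> R) :
  is_egf u f -> is_egf (fun n => u (S n)) (Derive f).
Proof.
  unfold is_egf; intros Hu.
  generalize (filter_and _ _ (locally_is_pseries_CV_radius _ _ Hu)
    (locally_locally _ _ Hu)).
  apply filter_imp; intros t [Rt Ht].
  rewrite <- (Derive_ext_loc (PSeries (fun n => u n / INR (fact n))) f t).
  - generalize (is_pseries_derive _ _ Rt).
    apply is_pseries_ext; intros n.
    change (INR (S n) * (u (S n) / INR (fact (S n))) = u (S n) / INR (fact n)).
    rewrite fact_simpl, mult_INR; field.
    split; [apply INR_fact_neq_0 | apply not_0_INR; lia].
  - revert Ht; apply filter_imp; intros s; apply is_pseries_unique.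
Qed.

Lemma is_egf_Derive_n (u : nat -> R) (f : R -> R) (N : nat) :
  is_egf u f -> is_egf (fun n => u (n + N)%nat) (Derive_n f N).
Proof.
  intros Hu; induction N as [|N IH].
  - revert Hu; apply is_egf_ext; intros n; now rewrite Nat.add_0_r.
  - generalize (is_egf_Derive _ _ IH).
    apply is_egf_ext; intros n; f_equal; lia.
Qed.

Lemma is_egf_1 : is_egf (falling 0) (fun _ => 1).
Proof.
  apply (filter_forall (F := locally (0 : R))); intros t; apply is_pseries_R.
  apply (filterlim_ext (fun _ => 1)); [|apply filterlim_const].
  intros n; rewrite sum_n_Reals; induction n as [|n IH].
  - simpl; field.
  - rewrite tech5, <- IH, falling_succ_l; unfold Rdiv; ring.
Qed.

Lemma is_egf_pow_affine (c : R) (M : nat) :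
  is_egf (fun n => falling (INR M) n * c ^ n) (fun t => (1 + c * t) ^ M).
Proof.
  induction M as [|M IH].
  - generalize is_egf_1; apply is_egf_ext; intros [|n]; [simpl; ring|].
    simpl INR; rewrite falling_succ_l; ring.
  - apply (is_egf_ext_loc _ (fun t => (1 + c * t) ^ M + c * (t * (1 + c * t) ^ M))).
    { apply filter_forall; intros t; simpl; ring. }
    generalize (is_egf_plus _ _ _ _ IH (is_egf_scal c _ _ (is_egf_mult_id _ _ IH))).
    apply is_egf_ext; intros n; rewrite S_INR, falling_add_1.
    destruct n as [|n]; simpl; ring.
Qed.

(** * Derivatives of the generating function *)

Definition fib_gf (x t : R) : R := Rpower (1 / (1 - t - t ^ 2)) x.

Lemma locally_fib_gf_domain (t : R) :
  0 < 1 - t - t ^ 2 -> locally t (fun s : R => 0 < 1 - s - s ^ 2).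
Proof.
  intros Ht.
  apply (open_comp (fun s : R => 1 - s - s ^ 2) (fun y => 0 < y)).
  - intros s _.
    apply (ex_derive_continuous (V := R_NormedModule) (fun s : R => 1 - s - s ^ 2)).
    auto_derive; exact I.
  - apply open_gt.
  - exact Ht.
Qed.

Lemma is_derive_fib_gf (x t : R) : 0 < 1 - t - t ^ 2 ->
  is_derive (fib_gf x) t (x * (1 + 2 * t) * fib_gf (x + 1) t).
Proof.
  intros Ht.
  assert (Hinv : 0 < 1 / (1 - t - t ^ 2)) by (apply Rdiv_lt_0_compat; lra).
  unfold fib_gf; rewrite Rpower_plus, Rpower_1 by exact Hinv.
  unfold Rpower; auto_derive.
  - split; [lra | split; [exact Hinv | exact I]].
  - replace (1 * / (1 + - t + - (t * (t * 1)))) with (1 / (1 - t - t ^ 2))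
      by (field; lra).
    field; lra.
Qed.

Lemma is_derive_pow_affine (c : R) (M : nat) (t : R) :
  is_derive (fun s => (1 + c * s) ^ M) t (c * INR M * (1 + c * t) ^ pred M).
Proof. auto_derive; [exact I | ring]. Qed.

(* For 2 i > N the truncated exponent N - 2 i is junk, but then coef_a i N = 0. *)
Definition fib_gf_term (x : R) (N i : nat) (t : R) : R :=
  rising x (N - i) * ((1 + 2 * t) ^ (N - 2 * i) * fib_gf (x + INR (N - i)) t).

Lemma is_derive_fib_gf_term (x t : R) (N i : nat) :
  0 < 1 - t - t ^ 2 -> (2 * i <= N)%nat ->
  is_derive (fib_gf_term x N i) t
    (fib_gf_term x (S N) i t
     + 2 * INR (N - 2 * i) * fib_gf_term x (S N) (S i) t).
Proof.
  intros Ht Hi; unfold fib_gf_term.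
  pose proof (is_derive_scal _ t (rising x (N - i)) _
    (is_derive_mult (K := R_AbsRing) _ _ t _ _
      (is_derive_pow_affine 2 (N - 2 * i) t)
      (is_derive_fib_gf (x + INR (N - i)) t Ht) Rmult_comm)) as Hprod.
  replace (S N - S i)%nat with (N - i)%nat by lia.
  replace (S N - 2 * S i)%nat with (pred (N - 2 * i)) by lia.
  replace (S N - i)%nat with (S (N - i)) by lia.
  replace (S N - 2 * i)%nat with (S (N - 2 * i)) by lia.
  rewrite (S_INR (N - i)), <- Rplus_assoc.
  evar_last; [exact Hprod|].
  unfold plus, mult; simpl; unfold mult; simpl; ring.
Qed.

Lemma Derive_n_fib_gf (x t : R) (N : nat) : 0 < 1 - t - t ^ 2 ->
  Derive_n (fib_gf x) N t =
  sum_f_R0 (fun i => coef_a i N * fib_gf_term x N i t) N.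
Proof.
  revert t; induction N as [|N IH]; intros t Ht.
  - unfold fib_gf_term; simpl; rewrite Rplus_0_r; change (coef_a 0 0) with 1; ring.
  - simpl Derive_n; rewrite sum_coef_a_succ.
    rewrite (Derive_ext_loc _
      (fun s => sum_f_R0 (fun i => coef_a i N * fib_gf_term x N i s) N) t).
    2:{ generalize (locally_fib_gf_domain t Ht); apply filter_imp; exact IH. }
    apply is_derive_unique, is_derive_sum_f_R0; intros i _.
    destruct (Nat.le_gt_cases (2 * i) N) as [Hi | Hi].
    + apply is_derive_scal, is_derive_fib_gf_term; assumption.
    + rewrite coef_a_eq_0, Rmult_0_l by lia.
      apply (is_derive_ext (fun _ => 0)); [intros s; symmetry; apply Rmult_0_l|].
      apply (is_derive_const (K := R_AbsRing) (V := R_NormedModule)).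
Qed.

Lemma convolved_fibonacci_is_egf (p : nat -> R -> R) (x : R) :
  convolved_fibonacci p -> is_egf (fun n => p n x) (fib_gf x).
Proof.
  unfold is_egf; intros hp; generalize (hp x); apply filter_imp; intros t Ht.
  apply is_pseries_R; revert Ht; apply is_series_ext; intros n.
  unfold Rdiv; simpl; ring.
Qed.

Lemma is_egf_Derive_n_fib_gf (p : nat -> R -> R) (N : nat) (x : R) :
  convolved_fibonacci p ->
  is_egf (fun k => sum_f_R0 (fun i => coef_a i N * (rising x (N - i)
      * binomial_convolution (fun l => falling (INR (N - 2 * i)) l * 2 ^ l)
          (fun n => p n (x + INR (N - i))) k)) N)
    (Derive_n (fib_gf x) N).
Proof.
  intros hp.
  apply (is_egf_ext_loc _
    (fun t => sum_f_R0 (fun i => coef_a i N * fib_gf_term x N i t) N)).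
  - assert (H0 : 0 < 1 - 0 - 0 ^ 2) by lra.
    generalize (locally_fib_gf_domain 0 H0); apply filter_imp; intros t Ht.
    symmetry; apply Derive_n_fib_gf, Ht.
  - apply (is_egf_sum (fun i k => coef_a i N * (rising x (N - i) * _))).
    intros i; apply is_egf_scal, is_egf_scal, is_egf_mult.
    + apply is_egf_pow_affine.
    + apply convolved_fibonacci_is_egf, hp.
Qed.

Theorem theorem7 (p : nat -> R -> R) (hp : convolved_fibonacci p)
    (k N : nat) (x : R) :
  p (k + N)%nat x =
  sum_f_R0 (fun i : nat =>
    sum_f_R0 (fun l : nat =>
      Binomial.C k l * falling (INR N - 2 * INR i) l * 2 ^ l
        * coef_a i N * rising x (N - i)
        * p (k - l)%nat (x + INR (N - i))) k)
    ((N + 1) / 2).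
Proof.
  pose proof (is_egf_Derive_n _ _ N (convolved_fibonacci_is_egf p x hp)) as Hshift.
  pose proof (is_egf_Derive_n_fib_gf p N x hp) as Hclosed.
  etransitivity; [exact (is_egf_unique _ _ _ k Hshift Hclosed)|]; cbv beta.
  rewrite sum_coef_a_truncate.
  apply sum_eq; intros i _; unfold binomial_convolution.
  destruct (Nat.le_gt_cases (2 * i) N) as [Hi | Hi].
  - rewrite minus_INR, mult_INR by exact Hi; change (INR 2) with 2.
    rewrite <- Rmult_assoc, scal_sum.
    apply sum_eq; intros l _; ring.
  - rewrite coef_a_eq_0, Rmult_0_l by lia.
    symmetry; apply sum_eq_R0; intros l _; ring.
Qed.
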